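(* Let $\Gamma=(X,R)$ be a bipartite distance-regular graph with diameter $D\ge 4$, valency $k\ge 3$ and eigenvalues $\theta_0>\theta_1>\cdots>\theta_D$. Put $d=\lfloor D/2\rfloor$, fix $x\in X$ and let $T=T(x)$. Choose $n\in\{1,d\}$ if $D$ is odd, and let $n=1$ if $D$ is even. Let $W$ be a thin irreducible $T$-module with endpoint $2$ and local eigenvalue $\tilde\theta_n=-1-\dfrac{b_2b_3}{\theta_n^2-b_2}$. Let $v$ be a nonzero vector in $E_2^*W$. Then $W=Mv$. The vectors $$E_iv\qquad(1\le i\le D-1,\ i\ne n,\ i\ne D-n)$$ form a basis for $W$, and $E_0v=0$, $E_nv=0$, $E_{D-n}v=0$, $E_Dv=0$.
   Context: Graphs are finite, undirected, connected, without loops or multiple edges; $\partial$ denotes path-length distance. A graph $\Gamma=(X,R)$ of diameter $D$ is distance-regular if for all $0\le h,i,j\le D$ and all $x,y\in X$ with $\partial(x,y)=h$ the number $p^h_{ij}=|\{z\in X:\partial(x,z)=i,\ \partial(z,y)=j\}|$ depends only on $h,i,j$. Write $c_i=p^i_{1,i-1}$, $b_i=p^i_{1,i+1}$, $k=b_0$ (the valency). $\Gamma$ is bipartite if $X$ can be partitioned into two subsets neither of which contains an edge. For $0\le i\le D$, $A_i\in\mathrm{Mat}_X(\mathbb C)$ is the $i$th distance matrix: its $(y,z)$ entry is $1$ if $\partial(y,z)=i$ and $0$ otherwise; $A=A_1$ is the adjacency matrix and $M$ is the subalgebra of $\mathrm{Mat}_X(\mathbb C)$ generated by $A$. The distinct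 eigenvalues of $A$ are $\theta_0>\cdots>\theta_D$ (real); $E_i$ is the primitive idempotent of $\theta_i$, i.e. the orthogonal projection of $V=\mathbb C^X$ onto the $\theta_i$-eigenspace of $A$. For bipartite $\Gamma$ with $D\ge4$, $\theta_1^2>b_2>\theta_d^2$. For fixed $x\in X$, $E_i^*=E_i^*(x)$ is the diagonal matrix in $\mathrm{Mat}_X(\mathbb C)$ with $(y,y)$ entry $1$ if $\partial(x,y)=i$ and $0$ otherwise. $T=T(x)$ is the subalgebra of $\mathrm{Mat}_X(\mathbb C)$ generated by $A,E_0^*,\ldots,E_D^*$. A $T$-module is a subspace $W\subseteq V$ with $BW\subseteq W$ for all $B\in T$; it is irreducible if it is nonzero and contains no $T$-modules other than $0$ and $W$. The endpoint of an irreducible $W$ is $\min\{i:E_i^*W\ne0\}$; $W$ is thin if $\dim E_i^*W\le1$ for $0\le i\le D$. If $W$ is thin irreducible with endpoint $2$, then $E_2^*W$ is a one-dimensional eigenspace for $E_2^*A_2E_2^*$; the corresponding eigenvalue is called the local eigenvalue of $W$. *)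

(* Defs.v *)
From HB Require Import structures.
From mathcomp Require Import all_boot all_order all_algebra.
From mathcomp Require Import reals.
From mathcomp Require Import complex.

Set Implicit Arguments.
Unset Strict Implicit.
Unset Printing Implicit Defensive.

Import Order.TTheory GRing.Theory Num.Theory.
Local Open Scope ring_scope.

Section Graphs.
Variables (X : finType) (e : rel X).

Definition simple_graph := symmetric e /\ irreflexive e.

Definition connected_graph := forall x y : X, connect e x y.

(* Least length of an e-path from x to y. Shortest paths have length < #|X|,
   so searching below #|X| suffices; the value is #|X| if there is no path. *)
Definition dist (x y : X) : nat :=
  find (fun n => [exists p : n.-tuple X, path e x p && (last x p == y)])
       (iota 0 #|X|).

Definition diameter : nat := \max_(xy : X * X) dist xy.1 xy.2.

Definition sphere_inter (i j : nat) (x y : X) : nat :=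
  #|[set z : X | (dist x z == i) && (dist z y == j)]|.

Definition distance_regular : Prop :=
  forall h i j : nat,
    (h <= diameter)%N -> (i <= diameter)%N -> (j <= diameter)%N ->
  forall x y x' y' : X, dist x y = h -> dist x' y' = h ->
    sphere_inter i j x y = sphere_inter i j x' y'.

(* p^h_{ij}, read off at some pair at distance h (and 0 if there is none);
   under [distance_regular] the chosen pair is irrelevant. *)
Definition inter_num (h i j : nat) : nat :=
  if [pick xy : X * X | dist xy.1 xy.2 == h] is Some xy
  then sphere_inter i j xy.1 xy.2 else 0%N.

Definition b_num (i : nat) : nat := inter_num i 1 i.+1.

Definition valency : nat := b_num 0.

Definition bipartite : Prop :=
  exists B : {set X},
    (forall y z, y \in B -> z \in B -> ~~ e y z) /\
    (forall y z, y \notin B -> z \notin B -> ~~ e y z).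

End Graphs.

Section Algebra.
Variables (R : realType) (m : nat).
Local Notation C := R[i].

Inductive gen_subalg (S : 'M[C]_m -> Prop) : 'M[C]_m -> Prop :=
| gen_subalg_gen B of S B : gen_subalg S B
| gen_subalg_one : gen_subalg S 1%:M
| gen_subalg_add B B' of gen_subalg S B & gen_subalg S B' :
    gen_subalg S (B + B')
| gen_subalg_scale (a : C) B of gen_subalg S B : gen_subalg S (a *: B)
| gen_subalg_mul B B' of gen_subalg S B & gen_subalg S B' :
    gen_subalg S (B *m B').

Definition mximg (B : 'M[C]_m) (W : {vspace 'cV[C]_m}) : {vspace 'cV[C]_m} :=
  (linfun (mulmx B : 'cV[C]_m -> 'cV[C]_m) @: W)%VS.

(* The matrix P such that v |-> P *m v is the orthogonal projection of C^m
   (with its Hermitian inner product) onto {u | B *m u = a *: u}. The library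
   notions act on row vectors, whence the transpositions; see [eigprojP]. *)
Definition eigproj (B : 'M[C]_m) (a : C) : 'M[C]_m :=
  (proj_ortho (eigenspace B^T a))^T.

Lemma eigprojP (B : 'M[C]_m) (a : C) (v : 'cV[C]_m) :
  B *m (eigproj B a *m v) = a *: (eigproj B a *m v) /\
  forall u : 'cV[C]_m, B *m u = a *: u ->
    dotmx (v - eigproj B a *m v)^T u^T = 0.
Proof.
have E : (eigproj B a *m v)^T = v^T *m proj_ortho (eigenspace B^T a).
  by rewrite trmx_mul trmxK.
split.
  apply: trmx_inj; rewrite trmx_mul E linearZ /= E.
  by apply/eigenspaceP; exact: proj_ortho_sub.
move=> u Bu; have su : (u^T <= eigenspace B^T a)%MS.
  by apply/eigenspaceP; rewrite -trmx_mul Bu linearZ.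
apply/eqP; rewrite -orthomxE linearB /= E.
by apply: submx_trans (proj_ortho_compl_sub _ _) _; rewrite submx_ortho.
Qed.

End Algebra.

Section Terwilliger.
Variables (R : realType) (X : finType) (e : rel X).
Local Notation C := R[i].
Local Notation Mat := 'M[C]_#|X|.
Local Notation V := 'cV[C]_#|X|.

Definition dist_mx (i : nat) : Mat :=
  \matrix_(r, s) (dist e (enum_val r) (enum_val s) == i)%:R.

Definition adj_mx : Mat := dist_mx 1.

Definition bose_mesner : Mat -> Prop := gen_subalg (eq adj_mx).

(* theta_0 > ... > theta_D are exactly the eigenvalues of the adjacency matrix;
   values of theta beyond D play no role. *)
Definition ordered_eigenvalues (D : nat) (theta : nat -> R) : Prop :=
  (forall i j, (i < j)%N -> (j <= D)%N -> theta j < theta i) /\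
  (forall a : C, eigenvalue adj_mx a <->
     exists2 i, (i <= D)%N & a = real_complex R (theta i)).

Definition prim_idem (theta : nat -> R) (i : nat) : Mat :=
  eigproj adj_mx (real_complex R (theta i)).

Variable x : X.

Definition dual_idem (i : nat) : Mat :=
  \matrix_(r, s) ((r == s) && (dist e x (enum_val r) == i))%:R.

Definition terwilliger : Mat -> Prop :=
  gen_subalg (fun B => B = adj_mx \/
    exists2 i, (i <= diameter e)%N & B = dual_idem i).

Definition is_Tmodule (W : {vspace V}) : Prop :=
  forall B, terwilliger B -> forall w, w \in W -> B *m w \in W.

Definition irreducible_Tmodule (W : {vspace V}) : Prop :=
  [/\ is_Tmodule W, W <> 0%VS
    & forall U : {vspace V}, is_Tmodule U -> (U <= W)%VS ->
        U = 0%VS \/ U = W].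

Definition has_endpoint (W : {vspace V}) (r : nat) : Prop :=
  mximg (dual_idem r) W <> 0%VS /\
  forall i, (i < r)%N -> mximg (dual_idem i) W = 0%VS.

Definition thin (W : {vspace V}) : Prop :=
  forall i, (i <= diameter e)%N -> (\dim (mximg (dual_idem i) W) <= 1)%N.

(* For W thin irreducible with endpoint 2, E_2^* W is a line of eigenvectors of
   E_2^* A_2 E_2^*, so [a] is unique. *)
Definition has_local_eigenvalue (W : {vspace V}) (a : C) : Prop :=
  forall w, w \in mximg (dual_idem 2) W ->
    (dual_idem 2 *m dist_mx 2 *m dual_idem 2) *m w = a *: w.

End Terwilliger.

(* Main.v *)
Require Import Defs.
From HB Require Import structures.
From mathcomp Require Import all_boot all_order all_algebra.
From mathcomp Require Import reals.
From mathcomp Require Import complex.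
From mathcomp Require Import spectral sesquilinear ring lra zify.

(** Write k for the valency, N for the squared norm of v and xi = theta_n^2, and let
    q(A) = (k^2 - A^2)(xi - A^2). The key point is that the squared norm of E_j v is a
    nonzero multiple of q(theta_j).

    The values F(B) = v* B v on the Bose-Mesner algebra are determined by those at the
    distance matrices ([bose_mesner_dist_span]). As v lives on the sphere of radius
    2 about x and the graph is bipartite, F(A_h) = 0 unless h is 0, 2 or 4;
    F(A_2) = eta N for the local eigenvalue eta; and the values at A_0, A_2, A_4 sum to
    0 because the coordinates of v do, the endpoint of W being 2. On the other hand
    q(A) is itself a combination of A_0, A_2, A_4 ([quarticE]), so that the trace of
    q(A) A_h also vanishes for all other h, and the three remaining traces sum to 0.
    The equation eta = -1 - b_2 b_3 / (xi - b_2) says exactly that the two triples are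
    proportional, hence F(B) is a multiple of tr (q(A) B) for every B in the algebra
    ([moments_quartic]). At B = E_j this trace is q(theta_j) tr E_j.

    The factor of proportionality is nonzero since xi is different from b_2. Indeed
    tr q(A) is a nonzero multiple of xi - b_2, while by the choice of n no two of the
    values q(theta_j) have opposite signs, and not all of them are 0
    ([theta_n_neq_b2]). The spectrum is symmetric with theta_0 = k, so the roots of q
    among the eigenvalues are theta_0, theta_D, theta_n and theta_(D-n); hence 0, D, n
    and D - n are exactly the j with E_j v = 0.

    Finally, the span U of the nonzero E_j v contains v and is stable under A, and it
    is contained in W. Induction on the radius of balls about x shows that a thin
    irreducible module is generated by v under A ([thin_irreducible_generated]),
    hence W = U. *)

Set Implicit Arguments.
Unset Strict Implicit.
Unset Printing Implicit Defensive.

Import Order.TTheory GRing.Theory Num.Theory.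
Local Open Scope ring_scope.
Local Open Scope sesquilinear_scope.

(** * Path-length distance *)

Section Distance.
Variables (X : finType) (e : rel X).
Hypotheses (e_sym : symmetric e) (e_irr : irreflexive e).
Hypothesis e_conn : connected_graph e.
Local Notation d := (dist e).
Local Notation D := (diameter e).
Local Open Scope nat_scope.
Implicit Types y z w : X.

Definition walk y z n := [exists p : n.-tuple X, path e y p && (last y p == z)].

Lemma walkP y z n :
  reflect (exists p, [/\ path e y p, last y p = z & size p = n]) (walk y z n).
Proof.
apply: (iffP existsP) => [[p /andP[pp /eqP lp]]|[p [pp lp sp]]].
  by exists p; rewrite size_tuple.
by rewrite -sp; exists (in_tuple p); rewrite pp lp eqxx.
Qed.

Lemma has_walk y z : has (walk y z) (iota 0 #|X|).
Proof.
have /connectP[p pp ->] := e_conn y z.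
case/shortenP: pp => p' pp' up' _.
apply/hasP; exists (size p'); last by apply/walkP; exists p'.
by rewrite mem_iota /= add0n; have := card_uniqP up' => /= <-; exact: max_card.
Qed.

Lemma dist_lt y z : d y z < #|X|.
Proof. by have := has_walk y z; rewrite has_find size_iota. Qed.

Lemma shortest_path y z :
  exists p, [/\ path e y p, last y p = z & size p = d y z].
Proof.
apply/walkP; have := nth_find 0 (has_walk y z).
by rewrite nth_iota ?add0n // dist_lt.
Qed.

Lemma dist_le_size y p : path e y p -> d y (last y p) <= size p.
Proof.
move=> pp; rewrite leqNgt; apply/negP => lt.
have := before_find 0 lt.
rewrite nth_iota ?add0n; last exact: ltn_trans lt (dist_lt _ _).
by move/walkP; case; exists p.
Qed.

Lemma dist_eq0 y z : (d y z == 0) = (y == z).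
Proof.
apply/eqP/eqP => [d0|->]; last first.
  by apply/eqP; rewrite -leqn0; exact: (@dist_le_size z [::]).
by have [p [_ lp sp]] := shortest_path y z; move: sp lp; rewrite d0; case: p.
Qed.

Lemma dist_refl y : d y y = 0.
Proof. by apply/eqP; rewrite dist_eq0. Qed.

Lemma dist_triangle w y z : d y z <= d y w + d w z.
Proof.
have [p [pp lp <-]] := shortest_path y w; have [q [pq lq <-]] := shortest_path w z.
by rewrite -size_cat -lq -lp -last_cat dist_le_size // cat_path pp lp.
Qed.

Lemma dist_sym y z : d y z = d z y.
Proof.
suff le u w : d u w <= d w u by apply/eqP; rewrite eqn_leq !le.
have [p [pp lp sp]] := shortest_path w u.
have := @dist_le_size u (rev (belast w p)).
rewrite size_rev size_belast sp -lp.
have -> : last (last w p) (rev (belast w p)) = w.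
  by case: (p) => //= a q; rewrite rev_cons last_rcons.
apply; rewrite rev_path.
by rewrite (eq_path (e' := e)) // => a b /=; rewrite e_sym.
Qed.

Lemma dist_eq1 y z : (d y z == 1) = e y z.
Proof.
apply/eqP/idP => [d1|yz].
  have [p [pp lp sp]] := shortest_path y z; move: sp pp lp; rewrite d1.
  by case: p => [//|a [|//]] _ /= /andP[? _] <-.
apply/eqP; rewrite eqn_leq; apply/andP; split.
  by apply: (@dist_le_size y [:: z]); rewrite /= yz.
rewrite lt0n dist_eq0; apply/eqP => yz0.
by move: yz; rewrite yz0 e_irr.
Qed.

Lemma dist_le_diam y z : d y z <= D.
Proof. exact: (leq_bigmax (y, z)). Qed.

Lemma dist_step y z i : d y z = i.+1 -> exists2 w, d y w = 1 & d w z = i.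
Proof.
move=> dyz; have [p [pp lp sp]] := shortest_path y z.
move: pp lp sp; rewrite dyz; case: p => //= w p /andP[yw pp] lp [sp].
move/eqP: yw; rewrite -dist_eq1 => /eqP/eqP yw; exists w => //.
apply/eqP; rewrite eqn_leq; apply/andP; split.
  by rewrite -lp -sp; apply: dist_le_size.
by rewrite -ltnS -dyz (leq_trans (dist_triangle w y z)) // yw.
Qed.

Lemma dist_pair h : h <= D -> #|X| > 0 -> exists y z, d y z = h.
Proof.
move=> hD X0.
have [y [z yzD]] : exists y z, d y z = D.
  have [|[y z] yzD] := @bigop.eq_bigmax _ (fun yz : X * X => d yz.1 yz.2).
    by rewrite card_prod muln_gt0 X0.
  by exists y, z; rewrite /diameter yzD.
have desc m : forall a b, d a b = m + h -> exists y z, d y z = h.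
  elim: m => [|m IH] a b; first by exists a, b.
  by rewrite addSn => /dist_step[w _ /IH].
by apply: (desc (D - h) y z); rewrite subnK.
Qed.

(** * Parity and intersection numbers *)

Definition c_num i : nat := inter_num e i 1 i.-1.

Section Bipartite.
Variable B : {set X}.
Hypothesis B_stable : forall y z, y \in B -> z \in B -> ~~ e y z.
Hypothesis B_costable : forall y z, y \notin B -> z \notin B -> ~~ e y z.

Lemma edge_parity y z : e y z -> (y \in B) (+) (z \in B).
Proof.
move=> yz; case: (boolP (y \in B)) => yB; case: (boolP (z \in B)) => zB //=.
  by have := B_stable yB zB; rewrite yz.
by have := B_costable yB zB; rewrite yz.
Qed.

Lemma dist_parity y z : odd (d y z) = (y \in B) (+) (z \in B).
Proof.
have [p [pp <- <-]] := shortest_path y z.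
elim: p y pp => [|w p IH] y /=; first by rewrite addbb.
move=> /andP[/edge_parity yw /IH ->]; move: yw.
by case: (y \in B); case: (w \in B); case: (_ \in B).
Qed.

Lemma dist_parity_cycle x y z : odd (d y z) = odd (d x y) (+) odd (d x z).
Proof.
rewrite !dist_parity.
by case: (x \in B); case: (y \in B); case: (z \in B).
Qed.
End Bipartite.

Section Regular.
Hypothesis e_bip : bipartite e.
Hypothesis e_dreg : distance_regular e.

Lemma odd_dist x y z : odd (d y z) = odd (d x y) (+) odd (d x z).
Proof. by have [B [B1 B2]] := e_bip; apply: dist_parity_cycle B1 B2 _ _ _. Qed.

Lemma sphere_interE h i j y z : h <= D -> i <= D -> j <= D -> d y z = h ->
  sphere_inter e i j y z = inter_num e h i j.
Proof.
move=> hD iD jD yz; rewrite /inter_num; case: pickP => [[a b] /= /eqP ab|/(_ (y, z))].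
  exact: e_dreg yz ab.
by rewrite /= yz eqxx.
Qed.

(** The two distances differ by at most one, and cannot agree because they have
    opposite parities. *)
Lemma dist_neighbour y w z : d y w = 1 -> d w z = (d y z).+1 \/ (d w z).+1 = d y z.
Proof.
move=> yw; have := odd_dist y w z; rewrite yw /=.
have := dist_triangle w y z; rewrite yw add1n => le1.
have := dist_triangle y w z; rewrite (dist_sym w y) yw add1n => le2.
case: (ltngtP (d w z) (d y z)) le1 le2 => [lt1 le1 _ _|lt1 _ le2 _|-> _ _].
- by right; apply/eqP; rewrite eqn_leq lt1 le1.
- by left; apply/eqP; rewrite eqn_leq lt1 le2.
- by case: (odd _).
Qed.

Lemma sphere_inter_eq0 i y z :
  d y z != i.-1 -> d y z != i.+1 -> 0 < i -> sphere_inter e 1 i y z = 0.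
Proof.
move=> ne1 ne2 i0; apply/eqP; rewrite cards_eq0; apply/eqP/setP => w.
rewrite !inE; apply/negP => /andP[/eqP yw /eqP wz].
case: (dist_neighbour z yw) ne1 ne2; rewrite wz => H.
  by rewrite H /= eqxx.
by rewrite H eqxx.
Qed.

Hypothesis D_gt0 : 0 < D.
Hypothesis X_gt0 : 0 < #|X|.

Lemma card_neighbours y : #|[set w | d y w == 1]| = valency e.
Proof.
rewrite /valency /b_num -(@sphere_interE 0 1 1 y y) ?dist_refl //.
by apply: eq_card => w; rewrite !inE (dist_sym w y) andbb.
Qed.

(** Each neighbour of y is either one step closer to z or one step further. *)
Lemma b_add_c i : 0 < i < D -> b_num e i + c_num i = valency e.
Proof.
move=> /andP[i0 iD]; have [y [z yz]] := dist_pair (ltnW iD) X_gt0.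
rewrite -(card_neighbours y) /b_num /c_num.
rewrite -!(@sphere_interE i _ _ y z) //; try exact: ltnW.
  2: exact: leq_trans (leq_pred _) (ltnW _).
rewrite /sphere_inter -cardsUI [X in _ + X]eq_card0 ?addn0.
  apply: eq_card => w; rewrite !inE -andb_orr; apply/andb_idr => /eqP yw.
  by move: (dist_neighbour z yw); rewrite yz => -[->|<-]; rewrite /= eqxx ?orbT.
move=> w; rewrite !inE; apply/negP => /andP[/andP[_ /eqP ->] /andP[_]].
by case: (i) => //= m; rewrite eqn_leq ltnNge leqW // andbF.
Qed.

Lemma c_gt0 i : 0 < i <= D -> 0 < c_num i.
Proof.
case: i => // i /andP[_ iD]; have [y [z yz]] := dist_pair iD X_gt0.
rewrite /c_num -(@sphere_interE i.+1 _ _ y z) //=; last exact: ltnW.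
have [w yw wz] := dist_step yz.
by apply/card_gt0P; exists w; rewrite !inE yw wz !eqxx.
Qed.

(** On a shortest path of length i + 1 from y to z, the second vertex w has y as
    a neighbour further from z. *)
Lemma b_gt0 i : i < D -> 0 < b_num e i.
Proof.
move=> iD; have [y [z yz]] := dist_pair iD X_gt0.
have [w yw wz] := dist_step yz.
rewrite /b_num -(@sphere_interE i _ _ w z) //; last exact: ltnW.
by apply/card_gt0P; exists y; rewrite !inE (dist_sym w) yw yz !eqxx.
Qed.

Lemma c1 : c_num 1 = 1.
Proof.
have [y [z yz]] := dist_pair D_gt0 X_gt0.
rewrite /c_num -(@sphere_interE 1 _ _ y z) //=.
rewrite /sphere_inter (eq_card (B := pred1 z)) ?card1 // => w.
rewrite !inE dist_eq0 andbC; case: eqP => //= ->.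
by rewrite yz.
Qed.

End Regular.
End Distance.

(** * Quadratic forms *)

Section QuadraticForm.
Variables (C : numClosedFieldType) (m : nat).

Lemma adj_mulmx_eq0 (u : 'cV[C]_m) : ((u^t* *m u) 0 0 == 0) = (u == 0).
Proof.
apply/eqP/eqP => [|->]; last by rewrite mulmx0 mxE.
have ge0 r : true -> 0 <= u^t* 0 r * u r 0 by rewrite !mxE mulrC mul_conjC_ge0.
rewrite mxE => /(psumr_eq0P ge0) H; apply/colP => r; rewrite mxE.
by have /eqP := H r isT; rewrite !mxE mulrC mul_conjC_eq0 => /eqP.
Qed.

Definition qform (v : 'cV[C]_m) (M : 'M[C]_m) : C := (v^t* *m M *m v) 0 0.

Lemma qform_sum (v : 'cV[C]_m) (I : finType) (a : I -> C) (M : I -> 'M[C]_m) :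
  qform v (\sum_i a i *: M i) = \sum_i a i * qform v (M i).
Proof.
rewrite /qform mulmx_sumr mulmx_suml summxE; apply: eq_bigr => i _.
by rewrite -scalemxAr -scalemxAl mxE.
Qed.

Lemma qformE (v : 'cV[C]_m) (M : 'M[C]_m) :
  qform v M = \sum_s \sum_r (v r 0)^* * M r s * v s 0.
Proof.
rewrite /qform mxE; apply: eq_bigr => s _; rewrite mxE mulr_suml.
by apply: eq_bigr => r _; rewrite !mxE.
Qed.

(** For an orthogonal projection M the form evaluates to the squared norm of
    M v. *)
Lemma qform_idem (v : 'cV[C]_m) (M : 'M[C]_m) :
  M^t* = M -> M *m M = M -> (qform v M == 0) = (M *m v == 0).
Proof.
move=> Madj Midem.
have -> : qform v M = ((M *m v)^t* *m (M *m v)) 0 0.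
  by rewrite trmx_mul map_mxM Madj /qform -{1}Midem !mulmxA.
exact: adj_mulmx_eq0.
Qed.
End QuadraticForm.

(** * The algebra spanned by the distance matrices *)

Section DistanceMatrices.
Variables (R : realType) (X : finType) (e : rel X).
Hypotheses (e_sym : symmetric e) (e_irr : irreflexive e).
Hypothesis e_conn : connected_graph e.
Local Notation C := R[i].
Local Notation Mat := 'M[C]_#|X|.
Local Notation d := (dist e).
Local Notation D := (diameter e).
Local Notation A_ := (dist_mx R e).
Local Notation A := (adj_mx R e).
Local Notation b i := ((b_num e i)%:R : C).
Local Notation c i := ((c_num e i)%:R : C).
Local Notation k := ((valency e)%:R : C).

Lemma mul_dist_mx i j r s :
  (A_ i *m A_ j) r s = (sphere_inter e i j (enum_val r) (enum_val s))%:R.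
Proof.
rewrite mxE (reindex_onto enum_rank enum_val) => [|t _]; last exact: enum_valK.
rewrite /sphere_inter cardsE -sum1_card natr_sum big_mkcond [RHS]big_mkcond /=.
apply: eq_bigr => w _; rewrite !mxE enum_rankK eqxx -natrM mulnb.
by rewrite unfold_in /=; case: (_ && _).
Qed.

Lemma dist_mx_sym i : (A_ i)^T = A_ i.
Proof. by apply/matrixP => r s; rewrite !mxE dist_sym. Qed.

Lemma dist_mx0 : A_ 0 = 1%:M.
Proof. by apply/matrixP => r s; rewrite !mxE dist_eq0 // (inj_eq enum_val_inj). Qed.

Lemma mxtrace_dist_mx i j : i != j -> \tr (A_ i *m A_ j) = 0.
Proof.
move=> ij; rewrite /mxtrace big1 // => r _; rewrite mul_dist_mx.
rewrite /sphere_inter [X in _%:R = X](_ : 0 = 0%:R) //; congr _%:R.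
apply/eqP; rewrite cards_eq0; apply/eqP/setP => w.
rewrite !inE; apply/negP => /andP[/eqP yw]; rewrite dist_sym // yw.
by rewrite (negPf ij).
Qed.

Lemma sum_dist_mx : \sum_(h < D.+1) A_ h = const_mx 1.
Proof.
apply/matrixP => r s; rewrite summxE mxE.
have lt : (d (enum_val r) (enum_val s) < D.+1)%N by rewrite ltnS dist_le_diam.
rewrite (bigD1 (Ordinal lt)) //= mxE eqxx big1 ?addr0 // => i ni.
by rewrite mxE [_ == _](_ : _ = false) //; apply/negbTE; rewrite eq_sym -val_eqE in ni *.
Qed.

Hypothesis e_dreg : distance_regular e.

Lemma adj_mul_dist_mx (i : 'I_D.+1) : (0 < D)%N ->
  A *m A_ i = \sum_(h < D.+1) (inter_num e h 1 i)%:R *: A_ h.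
Proof.
move=> D0; apply/matrixP => r s; rewrite mul_dist_mx summxE.
have lt : (d (enum_val r) (enum_val s) < D.+1)%N by rewrite ltnS dist_le_diam.
rewrite (bigD1 (Ordinal lt)) //= !mxE eqxx mulr1 big1 ?addr0 => [|h nh]; last first.
  rewrite !mxE [_ == _](_ : _ = false) ?mulr0 //.
  by apply/negbTE; rewrite eq_sym -val_eqE in nh *.
by rewrite (@sphere_interE _ _ e_dreg (d (enum_val r) (enum_val s))) // -ltnS.
Qed.

(** Distance-regularity makes the span of the distance matrices stable under
    multiplication by A, hence it contains the algebra that A generates. *)
Lemma bose_mesner_dist_span (B : Mat) : (0 < D)%N -> bose_mesner e B ->
  exists a : 'I_D.+1 -> C, B = \sum_h a h *: A_ h.
Proof.
move=> D0 BM.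
suff H S (a : 'I_D.+1 -> C) : S = \sum_h a h *: A_ h ->
    exists a' : 'I_D.+1 -> C, B *m S = \sum_h a' h *: A_ h.
  have [|a' E] := H 1%:M (fun h => (h == ord0)%:R); last by exists a'; rewrite -E mulmx1.
  rewrite (bigD1 ord0) //= scale1r dist_mx0 big1 ?addr0 // => h /negPf ->.
  by rewrite scale0r.
elim: BM S a => {B} [_ <-||B B' _ IH _ IH'|x B _ IH|B B' _ IH _ IH'] S a SE.
- exists (fun g => \sum_h a h * (inter_num e g 1 h)%:R).
  rewrite SE mulmx_sumr.
  under [RHS]eq_bigr do rewrite scaler_suml.
  rewrite exchange_big; apply: eq_bigr => h _ /=.
  rewrite -scalemxAr adj_mul_dist_mx // scaler_sumr.
  by apply: eq_bigr => g _; rewrite scalerA.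
- by exists a; rewrite mul1mx.
- have [a1 E1] := IH S a SE; have [a2 E2] := IH' S a SE.
  exists (fun h => a1 h + a2 h); rewrite mulmxDl E1 E2 -big_split /=.
  by apply: eq_bigr => h _; rewrite scalerDl.
- have [a1 E1] := IH S a SE.
  exists (fun h => x * a1 h); rewrite -scalemxAl E1 scaler_sumr.
  by apply: eq_bigr => h _; rewrite scalerA.
- have [a2 E2] := IH' S a SE; have [a1 E1] := IH _ _ E2.
  by exists a1; rewrite -mulmxA.
Qed.

Hypothesis e_bip : bipartite e.
Hypothesis X_gt0 : (0 < #|X|)%N.

(** No neighbour of y is as far from z as y itself, so the middle term of the
    three-term recurrence is absent. *)
Lemma adj_mul_dist_mx_bip i : (0 < i < D)%N ->
  A *m A_ i = b i.-1 *: A_ i.-1 + c i.+1 *: A_ i.+1.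
Proof.
case: i => // i /andP[_ iD]; apply/matrixP => r s; rewrite mul_dist_mx !mxE /=.
set y := enum_val r; set z := enum_val s.
have D1 : (1 <= D)%N by exact: leq_trans iD.
have [yz|n1] := eqVneq (d y z) i.
  rewrite yz eq_sym [(i.+2 == i)%N]gtn_eqF ?mulr0 ?addr0 ?mulr1; last by rewrite leqW.
  by rewrite /b_num -(@sphere_interE _ _ e_dreg i _ _ y z) // ltnW // ltnW.
have [yz|n2] := eqVneq (d y z) i.+2.
  rewrite mulr0 add0r mulr1.
  by rewrite /c_num -(@sphere_interE _ _ e_dreg i.+2 _ _ y z) // ltnW.
by rewrite !mulr0 addr0 sphere_inter_eq0.
Qed.

Lemma adj_sqr : (1 < D)%N -> A *m A = k%:M + c 2 *: A_ 2.
Proof. by move=> D1; rewrite adj_mul_dist_mx_bip //= dist_mx0 scalemx1. Qed.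

Lemma adj_mul_ones : (0 < D)%N -> A *m (const_mx 1 : 'cV_#|X|) = k *: const_mx 1.
Proof.
move=> D0; apply/colP => r; rewrite !mxE mulr1.
rewrite (reindex_onto enum_rank enum_val) => [|t _]; last exact: enum_valK.
rewrite -(card_neighbours e_sym e_conn e_dreg D0 (enum_val r)).
rewrite cardsE -sum1_card natr_sum big_mkcond [RHS]big_mkcond /=.
apply: eq_bigr => w _; rewrite !mxE enum_rankK eqxx mulr1.
by rewrite unfold_in /= -[eqn _ _]/(_ == 1%N); case: eqP.
Qed.

Hypothesis D_ge4 : (4 <= D)%N.

(** As a polynomial in A it has the roots k, -k and the two square roots of xi;
    xi will be theta_n^2. *)
Definition quartic (xi : C) : Mat := ((k ^+ 2)%:M - A *m A) *m (xi%:M - A *m A).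

(** Expand A^2 and A^4 by the recurrence and eliminate the c_i through
    b_i + c_i = k and c_1 = 1. *)
Lemma quarticE xi : quartic xi =
  (k * b 1 * (xi - b 2))%:M + (c 2 * (b 2 - xi - b 2 * b 3)) *: A_ 2
    + (c 2 * c 3 * c 4) *: A_ 4.
Proof.
have D0 : (0 < D)%N by exact: leq_trans D_ge4.
have D1 : (1 < D)%N by exact: leq_trans D_ge4.
have D2 : (2 < D)%N by exact: leq_trans D_ge4.
have bc i : (0 < i < D)%N -> c i = k - b i.
  move=> iD; rewrite -(b_add_c e_sym e_irr e_conn e_bip e_dreg D0 X_gt0 iD).
  by rewrite natrD addrC addKr.
have b1E : b 1 = k - 1.
  rewrite -(b_add_c e_sym e_irr e_conn e_bip e_dreg D0 X_gt0 (i := 1)) //.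
  by rewrite natrD c1 // addrK.
have A4 : A *m A *m (A *m A) = (k * (k + c 2 * b 1))%:M
   + (c 2 * (k + c 2 * b 1 + c 3 * b 2)) *: A_ 2 + (c 2 * c 3 * c 4) *: A_ 4.
  have AA2 : A *m A_ 2 = b 1 *: A + c 3 *: A_ 3 by rewrite adj_mul_dist_mx_bip.
  have AA3 : A *m A_ 3 = b 2 *: A_ 2 + c 4 *: A_ 4 by rewrite adj_mul_dist_mx_bip.
  rewrite {2}adj_sqr // mulmxDr mul_mx_scalar -scalemxAr -mulmxA AA2 mulmxDr.
  rewrite -!scalemxAr AA3 adj_sqr //.
  apply/matrixP => r s; rewrite !mxE; case: (r == s) => /=; ring.
rewrite /quartic mulmxBl !mulmxBr !mul_scalar_mx mul_mx_scalar A4 adj_sqr //.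
apply/matrixP => r s; rewrite !mxE (bc 2) ?(bc 3) // b1E.
case: (r == s) => /=; ring.
Qed.

Lemma mxtrace_quartic xi :
  \tr (quartic xi) = k * b 1 * (xi - b 2) * #|X|%:R.
Proof.
have tr0 i : (0 < i)%N -> \tr (A_ i) = 0.
  by move=> i0; rewrite -[A_ i]mul1mx -dist_mx0 mxtrace_dist_mx // ltn_eqF.
by rewrite quarticE !mxtraceD !mxtraceZ !tr0 // !mulr0 !addr0 mxtrace_scalar [RHS]mulr_natr.
Qed.

(** Counting closed walks through both factorizations of A A A_2 evaluates the
    valency of the distance-2 graph as k b_1 / c_2. *)
Lemma mxtrace_quartic2 xi :
  \tr (quartic xi *m A_ 2) = k * b 1 * (b 2 - xi - b 2 * b 3) * #|X|%:R.
Proof.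
have D1 : (1 < D)%N by exact: leq_trans D_ge4.
have D2 : (2 < D)%N by exact: leq_trans D_ge4.
have AA2 : A *m A_ 2 = b 1 *: A + c 3 *: A_ 3 by rewrite adj_mul_dist_mx_bip.
have tr2 : c 2 * \tr (A_ 2 *m A_ 2) = k * b 1 * #|X|%:R.
  have : \tr (A *m A *m A_ 2) = \tr (A *m (A *m A_ 2)) by rewrite mulmxA.
  rewrite {1}adj_sqr // AA2 mulmxDr -!scalemxAr adj_sqr // mulmxDl -!scalemxAl.
  rewrite !(mxtraceD, mxtraceZ, mul_scalar_mx) mxtrace_scalar.
  have tA2 : \tr (A_ 2) = 0 by rewrite -[A_ 2]mul1mx -dist_mx0 mxtrace_dist_mx.
  rewrite [\tr (A *m A_ 3)]mxtrace_dist_mx // tA2 !mulr0 !addr0 add0r => ->.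
  by rewrite -(mulr_natr k) mulrCA mulrA.
rewrite quarticE !mulmxDl !mxtraceD mul_scalar_mx -!scalemxAl !mxtraceZ.
rewrite [\tr (A_ 4 *m _)]mxtrace_dist_mx //.
have -> : \tr (A_ 2) = 0 by rewrite -[A_ 2]mul1mx -dist_mx0 mxtrace_dist_mx.
by rewrite !mulr0 add0r addr0 mulrAC tr2; ring.
Qed.

(** The all-ones matrix has image in the k-eigenspace of A, and k is a root of the
    quartic. *)
Lemma mxtrace_quartic_ones xi : \tr (quartic xi *m const_mx 1) = 0.
Proof.
have -> : const_mx 1 = (const_mx 1 : 'cV[C]_#|X|) *m (const_mx 1 : 'rV_#|X|).
  by apply/matrixP => r s; rewrite !mxE big_ord1 !mxE mulr1.
have D0 : (0 < D)%N by exact: leq_trans D_ge4.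
rewrite mulmxA (_ : quartic xi *m _ = 0) ?mul0mx ?mxtrace0 //.
have comm : quartic xi = (xi%:M - A *m A) *m ((k ^+ 2)%:M - A *m A).
  rewrite /quartic !mulmxBl !mulmxBr !mul_scalar_mx !mul_mx_scalar !scale_scalar_mx.
  move: (A *m A *m (A *m A)) (A *m A) => U S.
  by apply/matrixP => r s; rewrite !mxE [xi * _]mulrC; ring.
have AA1 : A *m A *m const_mx 1 = k ^+ 2 *: (const_mx 1 : 'cV[C]_#|X|).
  by rewrite -mulmxA adj_mul_ones // -scalemxAr adj_mul_ones // scalerA.
by rewrite comm -mulmxA [X in _ *m X]mulmxBl AA1 mul_scalar_mx subrr mulmx0.
Qed.

Lemma mxtrace_quartic_dist xi h : h != 0%N -> h != 2 -> h != 4 ->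
  \tr (quartic xi *m A_ h) = 0.
Proof.
move=> h0 h2 h4.
rewrite quarticE !mulmxDl !mxtraceD mul_scalar_mx -!scalemxAl !mxtraceZ.
have -> : \tr (A_ h) = 0 by rewrite -[A_ h]mul1mx -dist_mx0 mxtrace_dist_mx // eq_sym.
rewrite [\tr (A_ 2 *m _)]mxtrace_dist_mx 1?eq_sym //.
by rewrite [\tr (A_ 4 *m _)]mxtrace_dist_mx 1?eq_sym // !mulr0 !addr0.
Qed.

(** The all-ones matrix is the sum of the distance matrices, of which only those
    for 0, 2 and 4 contribute. *)
Lemma mxtrace_quartic4 xi :
  \tr (quartic xi *m A_ 4) = - (\tr (quartic xi) + \tr (quartic xi *m A_ 2)).
Proof.
apply/eqP; rewrite -addr_eq0; apply/eqP; rewrite -[RHS](mxtrace_quartic_ones xi).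
rewrite -sum_dist_mx mulmx_sumr raddf_sum /=.
have P i : (i <= 4)%N -> (i < D.+1)%N by move=> i4; rewrite ltnS (leq_trans i4).
rewrite (bigD1 (Ordinal (P 0 isT))) // (bigD1 (Ordinal (P 2 isT))) //.
rewrite (bigD1 (Ordinal (P 4 isT))) //= big1 => [|h].
  by rewrite dist_mx0 mulmx1 addr0 addrA [RHS]addrC.
by rewrite -!val_eqE /= => /andP[/andP[h0 h2] h4]; exact: mxtrace_quartic_dist.
Qed.

(** Both sides are linear in B, so it suffices to compare them on the distance
    matrices. There the hypotheses on F say that its values at A_0, A_2 and A_4 are
    proportional to the traces computed above; the equation for eta is the
    condition of proportionality at A_2, and the one at A_4 follows since both
    triples have sum 0. *)
Lemma moments_quartic (v : 'cV[C]_#|X|) (xi eta : C) (B : Mat) :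
  let F := qform v in
  eta * (xi - b 2) = b 2 - xi - b 2 * b 3 ->
  F (A_ 2) = eta * F 1%:M -> F (A_ 4) = - (1 + eta) * F 1%:M ->
  (forall h, h != 0%N -> h != 2 -> h != 4 -> F (A_ h) = 0) ->
  bose_mesner e B ->
  F B * (k * b 1 * (xi - b 2) * #|X|%:R) = F 1%:M * \tr (quartic xi *m B).
Proof.
move=> F eta_def F2 F4 F_ BM.
have D0 : (0 < D)%N by exact: leq_trans D_ge4.
have [a ->] := bose_mesner_dist_span D0 BM.
rewrite /F qform_sum -/F mulmx_sumr raddf_sum /= mulr_suml mulr_sumr; apply: eq_bigr => h _.
rewrite -scalemxAr mxtraceZ -mulrA [RHS]mulrCA; congr (_ * _).
have [->|h0] := eqVneq (h : nat) 0%N.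
  by rewrite dist_mx0 mulmx1 mxtrace_quartic.
have [->|h2] := eqVneq (h : nat) 2.
  rewrite F2 mxtrace_quartic2 -eta_def; ring.
have [->|h4] := eqVneq (h : nat) 4.
  rewrite F4 mxtrace_quartic4 mxtrace_quartic2 mxtrace_quartic -eta_def; ring.
by rewrite F_ // mxtrace_quartic_dist // mul0r mulr0.
Qed.
End DistanceMatrices.

(** * Functions of a Hermitian matrix *)

Lemma dotmx_subl (C : numClosedFieldType) m (u w z : 'rV[C]_m) :
  dotmx (u - w) z = dotmx u z - dotmx w z.
Proof. by rewrite !dotmxE mulmxBl [LHS]mxE; congr (_ + _); rewrite mxE. Qed.

Section SpectralCalculus.
Variables (C : numClosedFieldType) (m : nat) (S : 'M[C]_m).
Local Notation P := (spectralmx S).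
Local Notation ev := (spectral_diag S).
Hypothesis S_herm : S \is hermsymmx.
Implicit Types f g : C -> C.

(** The value f(S) in the functional calculus. Unlike a polynomial in S it can be
    formed directly from the indicator of an eigenvalue, which gives the primitive
    idempotents. *)
Definition fun_mx f : 'M[C]_m := invmx P *m diag_mx (map_mx f ev) *m P.

Definition eigen_ind (a z : C) : C := (z == a)%:R.

Let Punit : P \in unitmx. Proof. exact: spectral_unit. Qed.

Lemma spectral_decomposition : S = invmx P *m diag_mx ev *m P.
Proof. exact/orthomx_spectralP/hermitian_normalmx. Qed.

Lemma spectral_intertwining : P *m S = diag_mx ev *m P.
Proof.
by rewrite [X in _ *m X]spectral_decomposition !mulmxA mulmxV // mul1mx.
Qed.

Lemma fun_mx_id : fun_mx id = S.
Proof. by rewrite [RHS]spectral_decomposition /fun_mx map_mx_id. Qed.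

Lemma fun_mx_cst (a : C) : fun_mx (fun=> a) = a%:M.
Proof.
rewrite /fun_mx (_ : diag_mx _ = a%:M) ?mul_mx_scalar -?scalemxAl ?mulVmx ?scalemx1 //.
by apply/matrixP => r s; rewrite !mxE.
Qed.

Lemma fun_mxD f g : fun_mx (fun z => f z + g z) = fun_mx f + fun_mx g.
Proof.
rewrite /fun_mx -mulmxDl -mulmxDr -linearD; congr (_ *m diag_mx _ *m _).
by apply/rowP => r; rewrite !mxE.
Qed.

Lemma fun_mxZ a f : fun_mx (fun z => a * f z) = a *: fun_mx f.
Proof.
rewrite /fun_mx scalemxAl scalemxAr -linearZ; congr (_ *m diag_mx _ *m _).
by apply/rowP => r; rewrite !mxE.
Qed.

Lemma fun_mxM f g : fun_mx (fun z => f z * g z) = fun_mx f *m fun_mx g.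
Proof.
rewrite /fun_mx !mulmxA mulmxK // -(mulmxA _ (diag_mx _) (diag_mx _)) mulmx_diag.
congr (_ *m diag_mx _ *m _).
by apply/rowP => r; rewrite !mxE.
Qed.

Lemma spectral_diag_eigenvalue r : eigenvalue S (ev 0 r).
Proof.
apply/eigenvalueP; exists (row r P).
  rewrite -row_mul spectral_intertwining mul_diag_mx.
  by apply/rowP => s; rewrite !mxE.
apply/eqP => r0; have /eqP := congr1 (fun M => (M *m invmx P) 0 r) r0.
rewrite mul0mx -row_mul mulmxV // !mxE eqxx.
by rewrite oner_eq0.
Qed.

Lemma eigenvalue_spectral_diag a : eigenvalue S a -> exists r, ev 0 r = a.
Proof.
case/eigenvalueP => u uS u0; pose w := u *m invmx P.
have uw : u = w *m P by rewrite mulmxKV.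
have wD : w *m diag_mx ev = a *: w.
  rewrite -[LHS](mulmxK Punit) -(mulmxA w) -spectral_intertwining mulmxA -uw.
  by rewrite uS -scalemxAl.
move: w uw wD {uS} => w uw wD.
have /existsP[r wr] : [exists r, w 0 r != 0].
  apply: contraT; rewrite negb_exists => /forallP w0; case/eqP: u0.
  rewrite uw (_ : w = 0) ?mul0mx //; apply/rowP => r.
  by rewrite mxE; apply/eqP; have := w0 r; rewrite negbK.
exists r; apply: (mulfI wr); have /rowP/(_ r) := wD.
by rewrite mul_mx_diag !mxE mulrC [RHS]mulrC => ->.
Qed.

Lemma eq_fun_mx f g : (forall a, eigenvalue S a -> f a = g a) -> fun_mx f = fun_mx g.
Proof.
move=> fg; congr (_ *m diag_mx _ *m _); apply/rowP => r; rewrite !mxE.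
exact/fg/spectral_diag_eigenvalue.
Qed.

Lemma mxtrace_fun_mx f : \tr (fun_mx f) = \sum_r f (ev 0 r).
Proof.
rewrite /fun_mx -mulmxA mxtrace_mulC -mulmxA mulmxV // mulmx1 mxtrace_diag.
by apply: eq_bigr => r _; rewrite mxE.
Qed.

Lemma fun_mx_eigen f a (u : 'cV[C]_m) : S *m u = a *: u -> fun_mx f *m u = f a *: u.
Proof.
move=> Su; have : diag_mx ev *m (P *m u) = a *: (P *m u).
  by rewrite scalemxAr -Su !mulmxA spectral_intertwining.
rewrite /fun_mx -!mulmxA => Du.
suff -> : diag_mx (map_mx f ev) *m (P *m u) = f a *: (P *m u).
  by rewrite -scalemxAr mulmxA mulVmx // mul1mx.
move/colP: Du; rewrite !mul_diag_mx => Du.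
apply/colP => r; have := Du r; rewrite !mxE.
set y := \sum_(_ < _) _; have [->|y0] := eqVneq y 0; first by rewrite !mulr0.
by move/(mulIf y0) => ->.
Qed.

Lemma fun_mx_adjoint f : (forall z, (f z)^* = f z) -> (fun_mx f)^t* = fun_mx f.
Proof.
move=> fr; rewrite /fun_mx !invmx_unitary ?spectral_unitarymx //.
rewrite !trmx_mul !map_mxM /= trmxCK -mulmxA; congr (_ *m (_ *m _)).
by apply/matrixP => r s; rewrite !mxE rmorphMn /= fr eq_sym; case: eqP => // ->.
Qed.

Lemma mxtrace_eigen_ind_gt0 a : eigenvalue S a -> 0 < \tr (fun_mx (eigen_ind a)).
Proof.
case/eigenvalue_spectral_diag => r ra; rewrite mxtrace_fun_mx (bigD1 r) //= /eigen_ind.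
by rewrite ra eqxx ltr_pwDl // sumr_ge0.
Qed.

Lemma mul_eigen_ind f a : fun_mx f *m fun_mx (eigen_ind a) = f a *: fun_mx (eigen_ind a).
Proof.
rewrite -fun_mxM -fun_mxZ; apply: eq_fun_mx => z _.
by rewrite /eigen_ind; case: eqP => [->|_]; rewrite ?mulr0.
Qed.

Lemma mul_herm_eigen_ind a : S *m fun_mx (eigen_ind a) = a *: fun_mx (eigen_ind a).
Proof. by have := mul_eigen_ind id a; rewrite fun_mx_id. Qed.

(** The indicators of the eigenvalues sum to 1 on the spectrum. *)
Lemma sum_eigen_ind (I : finType) (a : I -> C) : injective a ->
  (forall z, eigenvalue S z -> exists i, z = a i) ->
  \sum_i fun_mx (eigen_ind (a i)) = 1%:M.
Proof.
move=> a_inj ev_a; rewrite /fun_mx -mulmx_suml -mulmx_sumr -linear_sum /=.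
rewrite -[RHS](fun_mx_cst 1) /fun_mx; congr (_ *m diag_mx _ *m _).
apply/rowP => r; rewrite summxE mxE.
have [i ri] := ev_a _ (spectral_diag_eigenvalue r).
rewrite (bigD1 i) //= !mxE ri /eigen_ind eqxx big1 ?addr0 // => j ji.
by rewrite mxE ri (inj_eq a_inj) eq_sym (negPf ji).
Qed.

Lemma eigen_ind_adjoint a : (fun_mx (eigen_ind a))^t* = fun_mx (eigen_ind a).
Proof. by apply: fun_mx_adjoint => z; rewrite conjC_nat. Qed.

Lemma eigen_ind_idem a :
  fun_mx (eigen_ind a) *m fun_mx (eigen_ind a) = fun_mx (eigen_ind a).
Proof. by rewrite mul_eigen_ind /eigen_ind eqxx scale1r. Qed.

Lemma eigen_ind_orthogonal_proj a (v : 'cV[C]_m) :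
  let p := fun_mx (eigen_ind a) *m v in
  S *m p = a *: p /\ forall u : 'cV[C]_m, S *m u = a *: u -> dotmx (v - p)^T u^T = 0.
Proof.
split=> [|u Su]; first by rewrite mulmxA mul_herm_eigen_ind -scalemxAl.
have uL : u^t* *m fun_mx (eigen_ind a) = u^t*.
  rewrite -eigen_ind_adjoint -map_mxM -trmx_mul.
  by rewrite (fun_mx_eigen _ Su) /eigen_ind eqxx scale1r.
have : u^t* *m (v - fun_mx (eigen_ind a) *m v) = 0 by rewrite mulmxBr mulmxA uL subrr.
move/(congr1 trmx); rewrite trmx_mul trmx0 dotmxE => H.
by rewrite -map_trmx H mxE.
Qed.

(** The difference of two orthogonal projections of v to the eigenspace lies in the
    eigenspace and is orthogonal to it. *)
Lemma orthogonal_proj_unique a (v p q : 'cV[C]_m) :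
  S *m p = a *: p -> (forall u : 'cV[C]_m, S *m u = a *: u -> dotmx (v - p)^T u^T = 0) ->
  S *m q = a *: q -> (forall u : 'cV[C]_m, S *m u = a *: u -> dotmx (v - q)^T u^T = 0) ->
  p = q.
Proof.
move=> Sp p_orth Sq q_orth.
have Sw : S *m (p - q) = a *: (p - q) by rewrite mulmxBr Sp Sq scalerBr.
apply/eqP; rewrite -subr_eq0 -adj_mulmx_eq0.
have -> : ((p - q)^t* *m (p - q)) 0 0 = dotmx (p - q)^T (p - q)^T.
  have -> : ((p - q)^t* *m (p - q)) 0 0 = ((p - q)^t* *m (p - q))^T 0 0 by rewrite [RHS]mxE.
  by rewrite dotmxE trmx_mul map_trmx.
have pqE : (p - q)^T = (v - q)^T - (v - p)^T by apply/rowP => r; rewrite !mxE; ring.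
by rewrite {1}pqE dotmx_subl p_orth // q_orth // subrr.
Qed.

End SpectralCalculus.

Section PrimitiveIdempotents.
Variables (R : realType) (m : nat) (S : 'M[R[i]]_m).
Local Notation C := R[i].
Hypothesis S_herm : S \is hermsymmx.

Lemma fun_mx_prod_gen_subalg (s : seq C) :
  gen_subalg (eq S) (fun_mx S (fun z => \prod_(b <- s) (z - b))).
Proof.
elim: s => [|b s IH].
  rewrite (eq_fun_mx S_herm (g := fun=> 1)) => [|z _]; last by rewrite big_nil.
  by rewrite fun_mx_cst; apply: gen_subalg_one.
rewrite (eq_fun_mx S_herm (g := fun z => (z - b) * \prod_(b <- s) (z - b))) => [|z _].
  rewrite fun_mxM fun_mxD (fun_mx_id S_herm) fun_mx_cst; apply: gen_subalg_mul => //.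
  apply: gen_subalg_add; first exact: gen_subalg_gen.
  by rewrite -scalemx1; apply/gen_subalg_scale/gen_subalg_one.
by rewrite big_cons.
Qed.

(** Lagrange interpolation: on the spectrum the indicator of a is a polynomial. *)
Lemma eigen_ind_gen_subalg (s : seq C) a :
  (forall z, eigenvalue S z -> z \in s) -> gen_subalg (eq S) (fun_mx S (eigen_ind a)).
Proof.
move=> evs; pose t := [seq b <- s | b != a].
have c0 : \prod_(b <- t) (a - b) != 0.
  by rewrite prodf_seq_neq0; apply/allP => b; rewrite mem_filter subr_eq0 eq_sym => /andP[].
rewrite (eq_fun_mx S_herm (g := fun z => (\prod_(b <- t) (a - b))^-1 * \prod_(b <- t) (z - b))).
  by rewrite fun_mxZ; apply/gen_subalg_scale/fun_mx_prod_gen_subalg.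
move=> z /evs zs; rewrite /eigen_ind; have [->|za] := eqVneq; first by rewrite mulVf.
rewrite [X in _ * X](_ : _ = 0) ?mulr0 //; apply/eqP.
by rewrite prodf_seq_eq0; apply/hasP; exists z; rewrite ?mem_filter ?za //= subrr.
Qed.

Lemma eigproj_fun_mx a : eigproj S a = fun_mx S (eigen_ind a).
Proof.
apply/matrixP => r s.
have [Ep E_orth] := eigprojP S a (delta_mx s 0).
have [Lp L_orth] := eigen_ind_orthogonal_proj S_herm a (delta_mx s 0).
have /(congr1 (fun M : 'cV_m => M r 0)) := orthogonal_proj_unique Ep E_orth Lp L_orth.
by rewrite -!colE !mxE.
Qed.

End PrimitiveIdempotents.

(** * The spectrum of a bipartite distance-regular graph *)

(** A finite set of reals has only one decreasing enumeration. *)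
Lemma decreasing_unique (R : realDomainType) (m : nat) (f g : nat -> R) :
  (forall i j, (i < j)%N -> (j <= m)%N -> f j < f i) ->
  (forall i j, (i < j)%N -> (j <= m)%N -> g j < g i) ->
  (forall i, (i <= m)%N -> exists2 j, (j <= m)%N & f i = g j) ->
  (forall i, (i <= m)%N -> exists2 j, (j <= m)%N & g i = f j) ->
  forall i, (i <= m)%N -> f i = g i.
Proof.
move=> fdec gdec fg gf.
have srt (h : nat -> R) : (forall i j, (i < j)%N -> (j <= m)%N -> h j < h i) ->
    sorted >%R (mkseq h m.+1).
  move=> hdec; apply/(sortedP 0) => i; rewrite size_mkseq => im.
  by rewrite !nth_mkseq ?(ltnW im) //; apply: hdec.
have sub (h h' : nat -> R) : (forall i, (i <= m)%N -> exists2 j, (j <= m)%N & h i = h' j) ->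
    forall a, a \in mkseq h m.+1 -> a \in mkseq h' m.+1.
  move=> hh' a; case/mapP => i; rewrite mem_iota add0n ltnS /= => /hh'[j jm ->] ->.
  by apply/mapP; exists j; rewrite // mem_iota add0n ltnS.
have E : mkseq f m.+1 = mkseq g m.+1.
  apply: (@irr_sorted_eq _ >%R) => [a b c ab bc|a|||a].
  - exact: lt_trans bc ab.
  - exact: ltxx.
  - exact: srt.
  - exact: srt.
  - by apply/idP/idP; apply: sub.
by move=> i im; have := congr1 (fun s => nth 0 s i) E; rewrite !nth_mkseq.
Qed.

Section GraphSpectrum.
Variables (R : realType) (X : finType) (e : rel X) (theta : nat -> R).
Hypotheses (e_sym : symmetric e) (e_irr : irreflexive e).
Hypothesis e_conn : connected_graph e.
Hypothesis e_dreg : distance_regular e.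
Hypothesis e_bip : bipartite e.
Local Notation C := R[i].
Local Notation D := (diameter e).
Local Notation A := (adj_mx R e).
Hypothesis D_gt0 : (0 < D)%N.
Hypothesis X_gt0 : (0 < #|X|)%N.
Hypothesis theta_eig : ordered_eigenvalues e D theta.

Lemma dist_mx_adjoint i : (dist_mx R e i)^t* = dist_mx R e i.
Proof.
by rewrite dist_mx_sym //; apply/matrixP => r s; rewrite !mxE conjC_nat.
Qed.

Lemma adj_mx_herm : A \is hermsymmx.
Proof. by apply/is_hermitianmxP; rewrite expr0 scale1r dist_mx_adjoint. Qed.

Lemma adj_mx_entry r s : A r s = (e (enum_val r) (enum_val s))%:R.
Proof. by rewrite mxE dist_eq1. Qed.

(** An eigenvector for a becomes one for -a when its sign is changed on one colour
    class. *)
Lemma eigenvalue_opp (a : C) : eigenvalue A a -> eigenvalue A (- a).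
Proof.
case/eigenvalueP => u uA u0; have [B [B1 B2]] := e_bip.
pose sg (r : 'I_#|X|) : C := (-1) ^+ (enum_val r \in B).
have sg2 r : sg r * sg r = 1 by rewrite -expr2 sqrr_sign.
apply/eigenvalueP; exists (\row_r (sg r * u 0 r)).
  apply/rowP => s; have := congr1 (fun M : 'rV_#|X| => - sg s * M 0 s) uA.
  rewrite !mxE mulr_sumr => H; rewrite mulNr -[a * _ in RHS]mulrCA.
  rewrite -mulNr -H; apply: eq_bigr => r _; rewrite adj_mx_entry mxE mulrA.
  case rs: (e _ _); rewrite ?mulr0 // !mulr1; congr (_ * _).
  have := edge_parity B1 B2 rs; rewrite /sg.
  by case: (_ \in B); case: (_ \in B) => //= _; rewrite ?opprK.
apply: contra_neq u0 => w0; apply/rowP => r; rewrite mxE.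
have := congr1 (fun M : 'rV_#|X| => sg r * M 0 r) w0.
by rewrite !mxE mulrA sg2 mul1r mulr0.
Qed.

Lemma adj_mul_ones_row : (const_mx 1 : 'rV[C]_#|X|) *m A = (valency e)%:R *: const_mx 1.
Proof.
apply: trmx_inj; rewrite trmx_mul dist_mx_sym // trmx_const linearZ /= trmx_const.
exact: adj_mul_ones.
Qed.

Lemma eigenvalue_valency : eigenvalue A (valency e)%:R.
Proof.
apply/eigenvalueP; exists (const_mx 1); first exact: adj_mul_ones_row.
apply/eqP => /rowP/(_ (Ordinal X_gt0)); rewrite !mxE => /eqP.
by rewrite oner_eq0.
Qed.

(** An eigenvalue is at most k in modulus: compare the l1 norms of the row
    vectors u and u A. *)
Lemma eigenvalue_le_valency (a : C) : eigenvalue A a -> `|a| <= (valency e)%:R.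
Proof.
case/eigenvalueP => u uA u0; pose N := \sum_r `|u 0 r|.
have N_gt0 : 0 < N.
  rewrite lt0r sumr_ge0 // andbT; apply: contra_neq u0 => N0.
  apply/rowP => r; rewrite mxE; apply/eqP; rewrite -normr_eq0; apply/eqP.
  by apply: (psumr_eq0P _ N0).
rewrite -(ler_pM2r N_gt0) /N mulr_sumr.
under eq_bigr => s _.
  rewrite -normrM (_ : a * u 0 s = (u *m A) 0 s); last by rewrite uA mxE.
  over.
have -> : (valency e)%:R * (\sum_r `|u 0 r|) = \sum_s \sum_r `|u 0 r| * A r s.
  rewrite exchange_big mulr_sumr; apply: eq_bigr => r _ /=.
  rewrite -mulr_sumr mulrC; congr (_ * _).
  have := congr1 (fun M : 'cV_#|X| => M r 0) (adj_mul_ones R e_sym e_conn e_dreg D_gt0).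
  by rewrite !mxE mulr1 => <-; apply: eq_bigr => s _; rewrite [const_mx _ _ _]mxE mulr1.
apply: ler_sum => s _; rewrite mxE; apply: le_trans (ler_norm_sum _ _ _) _.
by apply: ler_sum => r _; rewrite normrM adj_mx_entry normr_nat.
Qed.

Lemma theta_decr i j : (i < j)%N -> (j <= D)%N -> theta j < theta i.
Proof. exact: theta_eig.1. Qed.

Lemma theta_inj i j : (i <= D)%N -> (j <= D)%N -> theta i = theta j -> i = j.
Proof.
move=> iD jD; case: (ltngtP i j) => // lt.
  by move/eqP; rewrite gt_eqF // theta_decr.
by move/eqP; rewrite lt_eqF // theta_decr.
Qed.

(** The reversed sequence of the negatives enumerates the same spectrum in
    decreasing order. *)
Lemma theta_opp i : (i <= D)%N -> theta (D - i) = - theta i.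
Proof.
have [dec ev] := theta_eig.
have opp j : (j <= D)%N -> exists2 l, (l <= D)%N & - theta j = theta l.
  move=> jD; have : eigenvalue A (- real_complex R (theta j)).
    by apply: eigenvalue_opp; apply/ev; exists j.
  by case/ev => l lD; rewrite -rmorphN /= => /complexI E; exists l.
move=> iD; apply/esym/eqP; rewrite eqr_oppLR; apply/eqP; move: i iD.
apply: decreasing_unique => // [i j ij jD|i iD|i iD].
- rewrite ltrN2 dec ?leq_subr //.
  by rewrite ltn_sub2l // (leq_trans ij).
- have [l lD E] := opp i iD; exists (D - l)%N; rewrite ?leq_subr //.
  by rewrite subKn // -E opprK.
- by apply: opp; rewrite leq_subr.
Qed.

Lemma theta_0 : theta 0 = (valency e)%:R.
Proof.
have [dec ev] := theta_eig.
have [i iD kE] : exists2 i, (i <= D)%N & (valency e)%:R = real_complex R (theta i).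
  exact/ev/eigenvalue_valency.
have {}kE : (valency e)%:R = theta i.
  by apply: complexI; rewrite -kE rmorph_nat.
apply/eqP; rewrite eq_le; apply/andP; split; last first.
  rewrite kE; case: i iD {kE} => // i iD; exact/ltW/dec.
have /eigenvalue_le_valency : eigenvalue A (real_complex R (theta 0)) by apply/ev; exists 0%N.
rewrite -(rmorph_nat (real_complex R)) normc_def /=.
rewrite expr0n /= addr0 sqrtr_sqr lecR.
exact/le_trans/ler_norm.
Qed.

End GraphSpectrum.

(** * Thin irreducible modules of endpoint 2 *)

Lemma memv_mximg (R : realType) (m : nat) (B : 'M[R[i]]_m) (W : {vspace 'cV[R[i]]_m}) w :
  w \in W -> B *m w \in mximg B W.
Proof. by move=> wW; rewrite -[B *m w]/(mulmx B w) -lfunE memv_img. Qed.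

Lemma mximgP (R : realType) (m : nat) (B : 'M[R[i]]_m) (W : {vspace 'cV[R[i]]_m}) u :
  u \in mximg B W -> exists2 w, w \in W & u = B *m w.
Proof. by case/memv_imgP => w wW ->; exists w; rewrite // lfunE. Qed.

Lemma dimv_le1_mem (K : fieldType) (V : vectType K) (L : {vspace V}) (a b : V) :
  (\dim L <= 1)%N -> a \in L -> a != 0 -> b \in L -> exists c, b = c *: a.
Proof.
move=> L1 aL a0 bL; apply/vlineP.
suff -> : <[a]>%VS = L by [].
by apply/eqP; rewrite eqEdim -memvE aL dim_vline a0.
Qed.

Section SpectralSpan.
Variables (R : realType) (m : nat) (S : 'M[R[i]]_m) (v : 'cV[R[i]]_m).
Variable a : nat -> R[i].
Hypothesis S_herm : S \is hermsymmx.
Local Notation C := R[i].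
Local Notation E i := (fun_mx S (eigen_ind (a i))).

Lemma span_eigen_ind_stable s (u : 'cV[C]_m) :
  u \in <<[seq E i *m v | i <- s]>>%VS -> S *m u \in <<[seq E i *m v | i <- s]>>%VS.
Proof.
set U := <<_>>%VS => uU.
suff : (mximg S U <= U)%VS by move/subvP; apply; apply: memv_mximg.
rewrite /mximg limg_span; apply/span_subvP => w /mapP[_ /mapP[i si ->] ->].
rewrite lfunE /= mulmxA mul_herm_eigen_ind // -scalemxAl memvZ //.
by apply: memv_span; apply: map_f.
Qed.

Lemma span_eigen_ind_gen_subalg s (u : 'cV[C]_m) :
  (forall i, i \in s -> gen_subalg (eq S) (E i)) ->
  u \in <<[seq E i *m v | i <- s]>>%VS -> exists2 B, gen_subalg (eq S) B & u = B *m v.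
Proof.
elim: s u => [|i s IH] u gen /=.
  rewrite span_nil memv0 => /eqP ->; exists (0 *: 1%:M); last by rewrite scale0r mul0mx.
  exact/gen_subalg_scale/gen_subalg_one.
rewrite span_cons => /memv_addP[_ /vlineP[c ->]] [w wU ->].
have [|B BS ->] := IH w _ wU; first by move=> j js; apply: gen; rewrite inE js orbT.
exists (c *: E i + B); last by rewrite mulmxDl scalemxAl.
by apply: gen_subalg_add => //; apply/gen_subalg_scale/gen; rewrite inE eqxx.
Qed.

(** The projection E i kills the other vectors of the family and fixes its own. *)
Lemma free_eigen_ind s : uniq s -> {in s &, injective a} ->
  (forall i, i \in s -> E i *m v != 0) -> free [seq E i *m v | i <- s].
Proof.
elim: s => [|i s IH] /=; first by rewrite nil_free.
move=> /andP[iNs us] inj ne0; rewrite free_cons IH //; first last.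
- by move=> j js; apply: ne0; rewrite inE js orbT.
- by move=> j l js ls; apply: inj; rewrite inE ?js ?ls orbT.
rewrite andbT; apply: contra (ne0 i _); last by rewrite inE eqxx.
have sub : (<<[seq E j *m v | j <- s]>> <= lker (linfun (mulmx (E i) : 'cV_m -> 'cV_m)))%VS.
  apply/span_subvP => w /mapP[j js ->]; rewrite memv_ker lfunE /= mulmxA mul_eigen_ind //.
  rewrite {1}/eigen_ind (_ : a j == a i = false) ?scale0r ?mul0mx //.
  apply/negP => /eqP ji; case/negP: iNs.
  by rewrite -(inj j i) // inE ?js ?eqxx ?orbT.
move/(subvP sub); rewrite memv_ker lfunE /= mulmxA.
by rewrite eigen_ind_idem.
Qed.
End SpectralSpan.

Section TModules.
Variables (R : realType) (X : finType) (e : rel X) (x : X).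
Hypotheses (e_sym : symmetric e) (e_irr : irreflexive e).
Hypothesis e_conn : connected_graph e.
Local Notation C := R[i].
Local Notation V := 'cV[C]_#|X|.
Local Notation D := (diameter e).
Local Notation A := (adj_mx R e).
Local Notation Es := (dual_idem R e x).
Local Notation dx r := (dist e x (enum_val r)).
Implicit Types (W U : {vspace V}) (w u v : V).

Lemma dual_idemE i w r : (Es i *m w) r 0 = if dx r == i then w r 0 else 0.
Proof.
rewrite mxE (bigD1 r) //= mxE eqxx /= big1 ?addr0 => [|s /negPf sr].
  by case: (_ == i); rewrite ?mul1r ?mul0r.
by rewrite mxE eq_sym sr mul0r.
Qed.

Lemma Tmodule_generators W :
  (forall w, w \in W -> A *m w \in W) ->
  (forall i w, (i <= D)%N -> w \in W -> Es i *m w \in W) -> is_Tmodule e x W.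
Proof.
move=> WA WE B; elim=> {B} [B [->|[i iD ->]]||B B' _ IH _ IH'|a B _ IH|B B' _ IH _ IH'] w wW.
- exact: WA.
- exact: WE.
- by rewrite mul1mx.
- by rewrite mulmxDl memvD ?IH ?IH'.
- by rewrite -scalemxAl memvZ ?IH.
- by rewrite -mulmxA IH ?IH'.
Qed.

Lemma adj_Tmodule W w : is_Tmodule e x W -> w \in W -> A *m w \in W.
Proof. by move=> WT; apply: WT; apply: gen_subalg_gen; left. Qed.

Lemma dual_idem_Tmodule W w i :
  is_Tmodule e x W -> w \in W -> (i <= D)%N -> Es i *m w \in W.
Proof. by move=> WT wW iD; apply: WT => //; apply: gen_subalg_gen; right; exists i. Qed.

Lemma bose_mesner_Tmodule W w B :
  is_Tmodule e x W -> w \in W -> bose_mesner e B -> B *m w \in W.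
Proof.
move=> WT wW BM; apply: WT => //.
elim: BM => {B} [_ <-||B B' _ IH _ IH'|a B _ IH|B B' _ IH _ IH'].
- by apply: gen_subalg_gen; left.
- exact: gen_subalg_one.
- exact: gen_subalg_add.
- exact: gen_subalg_scale.
- exact: gen_subalg_mul.
Qed.

(** The projection onto the vertices at distance at least t from x; its kernel
    consists of the vectors supported on the ball of radius t - 1. *)
Definition outer_proj t : 'M[C]_#|X| := \matrix_(r, s) ((r == s) && (t <= dx r)%N)%:R.

Definition ball_part W t : {vspace V} :=
  (W :&: lker (linfun (mulmx (outer_proj t) : V -> V)))%VS.

Lemma outer_projE t w r : (outer_proj t *m w) r 0 = if (t <= dx r)%N then w r 0 else 0.
Proof.
rewrite mxE (bigD1 r) //= mxE eqxx /= big1 ?addr0 => [|s /negPf sr].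
  by case: (t <= _)%N; rewrite ?mul1r ?mul0r.
by rewrite mxE eq_sym sr mul0r.
Qed.

Lemma ball_partP W t w :
  reflect (w \in W /\ forall r, (t <= dx r)%N -> w r 0 = 0) (w \in ball_part W t).
Proof.
rewrite memv_cap memv_ker lfunE /=; apply: (iffP andP) => [[wW /eqP w0]|[wW w0]].
  by split=> // r tr; have := outer_projE t w r; rewrite tr w0 mxE => <-.
split=> //; apply/eqP/colP => r; rewrite outer_projE mxE.
by case: ifP => // /w0.
Qed.

Lemma adj_ball w t : (forall r, (t <= dx r)%N -> w r 0 = 0) ->
  forall r, (t.+1 <= dx r)%N -> (A *m w) r 0 = 0.
Proof.
move=> w0 r tr; rewrite mxE big1 // => s _; rewrite mxE.
case: eqP => [rs|_]; last by rewrite mul0r.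
rewrite w0 ?mulr0 //; have := dist_triangle e_conn (enum_val s) x (enum_val r).
by rewrite (dist_sym e_sym e_conn (enum_val s)) rs addn1 => /(leq_trans tr).
Qed.

(** Induction on the radius t. If A leaves the part of W in the ball of radius
    t - 1 stable, then that part is a T-module, hence all of W. Otherwise A maps
    one of its vectors out of the ball, and by thinness that image and the part
    itself span the part in the next ball. *)
Lemma thin_irreducible_generated W v U :
  irreducible_Tmodule e x W -> thin e x W -> has_endpoint e x W 2 -> (2 <= D)%N ->
  v \in mximg (Es 2) W -> v != 0 ->
  v \in U -> (forall u, u \in U -> A *m u \in U) -> (W <= U)%VS.
Proof.
move=> [WT _ Wmin] Wthin [_ Wend] D2 vE v0 vU UA.
have vW : v \in W.
  by have [w wW ->] := mximgP vE; apply: dual_idem_Tmodule.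
(* W has no component at distance 0 or 1 from x, so the vectors of W in the ball
   of radius 2 are those of E_2* W and the induction starts there. *)
suff H t : (ball_part W t.+3 <= U)%VS.
  apply/subvP => w wW; apply: (subvP (H D)); apply/ball_partP; split=> // r.
  by rewrite leqNgt ltnS (leq_trans (dist_le_diam _ _ _)) // ltnW // ltnW.
elim: t => [|t IH].
  apply/subvP => w /ball_partP[wW w3].
  suff [c ->] : exists c, w = c *: v by rewrite memvZ.
  apply: (dimv_le1_mem (Wthin 2 D2)) => //.
  suff -> : w = Es 2 *m w by apply: memv_mximg.
  have small i : (i < 2)%N -> Es i *m w = 0.
    by move=> i2; apply/eqP; rewrite -memv0 -(Wend i i2) memv_mximg.
  apply/colP => r; rewrite dual_idemE; case: eqP => // /eqP r2.
  move: r2; rewrite neq_ltn => /orP[r2|/w3 //].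
  by have /colP/(_ r) := small _ r2; rewrite dual_idemE eqxx mxE.
set S := ball_part W t.+3 in IH.
have SW : (S <= W)%VS by exact: capvSl.
have [tD|tD] := leqP t.+3 D; last first.
  apply: subv_trans IH; apply/subvP => w /ball_partP[wW _]; apply/ball_partP; split=> // r tr.
  by have := leq_trans (leq_trans tD tr) (dist_le_diam _ _ _); rewrite ltnn.
have [SA|/subvPn[_ /mximgP[s sS ->] As]] := boolP (mximg A S <= S)%VS.
  have ST : is_Tmodule e x S.
    apply: Tmodule_generators => [w wS|i w iD /ball_partP[wW w0]].
      by apply: (subvP SA); apply: memv_mximg.
    apply/ball_partP; split; first exact: dual_idem_Tmodule.
    by move=> r /w0; rewrite dual_idemE => ->; rewrite if_same.
  have vS : v \in S.
    apply/ball_partP; split=> // r tr; have [w _ ->] := mximgP vE.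
    by rewrite dual_idemE gtn_eqF // (leq_trans _ tr).
  have [S0|SeqW] := Wmin S ST SW.
    by case/negP: v0; rewrite -memv0 -S0.
  by apply: subv_trans IH; rewrite SeqW capvSl.
have [sW s0] := ball_partP _ _ _ sS.
have AsW : A *m s \in W by exact: adj_Tmodule.
have AsU : A *m s \in U by apply: UA; apply: (subvP IH).
have EAs0 : Es t.+3 *m (A *m s) != 0.
  apply: contra As => /eqP E0; apply/ball_partP; split=> // r.
  rewrite leq_eqVlt => /orP[/eqP tr|]; last exact: adj_ball.
  by have /colP/(_ r) := E0; rewrite dual_idemE -tr eqxx [RHS]mxE.
apply/subvP => w /ball_partP[wW w0].
have [c Ew] := dimv_le1_mem (Wthin _ tD) (memv_mximg _ AsW) EAs0 (memv_mximg (Es t.+3) wW).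
rewrite -[w](subrK (c *: (A *m s))) memvD ?memvZ //.
apply: (subvP IH); apply/ball_partP; split; first by rewrite memvB ?memvZ.
move=> r tr; suff wr : w r 0 = c * (A *m s) r 0 by rewrite 3!mxE wr subrr.
move: tr; rewrite leq_eqVlt => /orP[/eqP tr|tr].
  by have /colP/(_ r) := Ew; rewrite [RHS]mxE !dual_idemE -tr eqxx.
by rewrite w0 // (adj_ball s0) // mulr0.
Qed.
End TModules.

(** * The values of the form of v at the distance matrices *)

Section LocalMoments.
Variables (R : realType) (X : finType) (e : rel X) (x : X).
Hypotheses (e_sym : symmetric e) (e_irr : irreflexive e).
Hypothesis e_conn : connected_graph e.
Hypothesis e_bip : bipartite e.
Hypothesis e_dreg : distance_regular e.
Local Notation C := R[i].
Local Notation V := 'cV[C]_#|X|.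
Local Notation D := (diameter e).
Local Notation A_ := (dist_mx R e).
Local Notation Es := (dual_idem R e x).
Local Notation dx r := (dist e x (enum_val r)).
Hypothesis D_ge4 : (4 <= D)%N.
Hypothesis X_gt0 : (0 < #|X|)%N.

Variables (W : {vspace V}) (v : V) (eta : C).
Hypothesis W_T : is_Tmodule e x W.
Hypothesis W_end : has_endpoint e x W 2.
Hypothesis W_loc : has_local_eigenvalue e x W eta.
Hypothesis v_in : v \in mximg (Es 2) W.
Local Notation F M := (qform v M).

Lemma endpoint_supp r : dx r != 2 -> v r 0 = 0.
Proof. by have [w _ ->] := mximgP v_in; rewrite dual_idemE => /negPf ->. Qed.

Lemma dual_idem_endpoint : Es 2 *m v = v.
Proof.
by apply/colP => r; rewrite dual_idemE; case: eqP => // /eqP /endpoint_supp.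
Qed.

(** The entry of A A v at x is c_2 times the coordinate sum of v, and it lies in
    the component of W at distance 0 from x. *)
Lemma sum_endpoint : \sum_r v r 0 = 0.
Proof.
have D0 : (0 < D)%N by exact: leq_trans D_ge4.
have D1 : (1 < D)%N by exact: leq_trans D_ge4.
have vW : v \in W.
  by have [w wW ->] := mximgP v_in; apply: dual_idem_Tmodule.
have : Es 0 *m (adj_mx R e *m (adj_mx R e *m v)) = 0.
  apply/eqP; rewrite -memv0 -(W_end.2 0 isT).
  by apply: memv_mximg; do 2 apply: (adj_Tmodule W_T).
move/colP/(_ (enum_rank x)); rewrite dual_idemE enum_rankK dist_refl // eqxx.
rewrite mulmxA adj_sqr // mulmxDl mul_scalar_mx -scalemxAl [RHS]mxE.
rewrite mxE [X in X + _]mxE endpoint_supp ?enum_rankK ?dist_refl // mulr0 add0r mxE.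
have c2 : (0 < c_num e 2)%N by apply: c_gt0.
move/eqP; rewrite mulf_eq0 pnatr_eq0 (gtn_eqF c2) /=.
rewrite mxE => /eqP sum0; rewrite -[RHS]sum0; apply: eq_bigr => r _.
rewrite mxE enum_rankK; case: (eqVneq (dx r) 2) => [_|/endpoint_supp ->].
  by rewrite mul1r.
by rewrite mulr0.
Qed.

(** Two vertices at distance 2 from x are at even distance at most 4. *)
Lemma moment0 h : h != 0%N -> h != 2 -> h != 4 -> F (A_ h) = 0.
Proof.
move=> h0 h2 h4; rewrite qformE big1 // => s _.
rewrite big1 // => r _.
have [s2|/endpoint_supp ->] := eqVneq (dx s) 2; last by rewrite mulr0.
have [r2|/endpoint_supp ->] := eqVneq (dx r) 2; last by rewrite conjC0 !mul0r.
rewrite mxE [_ == h](_ : _ = false) ?mulr0 ?mul0r //; apply/negbTE/eqP => rs.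
have := dist_triangle e_conn x (enum_val r) (enum_val s).
rewrite (dist_sym e_sym e_conn _ x) r2 s2 rs => le4.
have := odd_dist e_conn e_bip x (enum_val r) (enum_val s); rewrite r2 s2 rs /=.
by case: h h0 h2 h4 le4 {rs} => [|[|[|[|[|h]]]]].
Qed.

Lemma moment2 : F (A_ 2) = eta * F 1%:M.
Proof.
have E2adj : v^t* *m Es 2 = v^t*.
  rewrite -{2}dual_idem_endpoint trmx_mul map_mxM; congr (_ *m _).
  by apply/matrixP => r s; rewrite !mxE; have [->|] := eqVneq s r; rewrite /= ?conjC_nat.
have -> : F (A_ 2) = (v^t* *m (Es 2 *m A_ 2 *m Es 2 *m v)) 0 0.
  by rewrite /qform !mulmxA E2adj -[in RHS]mulmxA dual_idem_endpoint.
by rewrite W_loc // -scalemxAr /qform mulmx1 mxE.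
Qed.

(** The form vanishes at the all-ones matrix, which is the sum of the distance
    matrices. *)
Lemma moment4 : F (A_ 4) = - (1 + eta) * F 1%:M.
Proof.
have ones : F (const_mx 1) = 0.
  rewrite /qform -mulmxA (_ : const_mx 1 *m v = 0) ?mulmx0 ?mxE //.
  apply/colP => r; rewrite !mxE -[RHS]sum_endpoint; apply: eq_bigr => s _.
  by rewrite mxE mul1r.
have : \sum_(h < D.+1) F (A_ h) = 0.
  rewrite -[RHS]ones -(sum_dist_mx R e).
  under [in RHS]eq_bigr do rewrite -[A_ _]scale1r.
  by rewrite qform_sum; apply: eq_bigr => h _; rewrite mul1r.
have P i : (i <= 4)%N -> (i < D.+1)%N by move=> i4; rewrite ltnS (leq_trans i4).
rewrite (bigD1 (Ordinal (P 0 isT))) // (bigD1 (Ordinal (P 2 isT))) //.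
rewrite (bigD1 (Ordinal (P 4 isT))) //= big1 => [|h].
  rewrite moment2 dist_mx0 // addr0 addrA -{1}[F 1%:M]mul1r -mulrDl.
  by move/eqP; rewrite addr_eq0 => /eqP E; rewrite mulNr E opprK.
by rewrite -!val_eqE /= => /andP[/andP[h0 h2] h4]; exact: moment0.
Qed.
End LocalMoments.

(** * Roots of the quartic among the eigenvalues *)

Lemma n_bounds D n : (4 <= D)%N -> n = 1%N \/ (odd D /\ n = D./2) -> (0 < n < D)%N.
Proof. by move=> D4 [->|[oD ->]]; lia. Qed.

Section EigenvalueOrder.
Variables (R : realType) (X : finType) (e : rel X) (theta : nat -> R).
Hypotheses (e_sym : symmetric e) (e_irr : irreflexive e).
Hypothesis e_conn : connected_graph e.
Hypothesis e_dreg : distance_regular e.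
Hypothesis e_bip : bipartite e.
Local Notation C := R[i].
Local Notation D := (diameter e).
Local Notation A := (adj_mx R e).
Local Notation k := ((valency e)%:R : R).
Local Notation b2 := ((b_num e 2)%:R : R).
Hypothesis D_ge4 : (4 <= D)%N.
Hypothesis X_gt0 : (0 < #|X|)%N.
Hypothesis theta_eig : ordered_eigenvalues e D theta.
Variable n : nat.
Hypothesis n_choice : n = 1%N \/ (odd D /\ n = D./2).

Let D_gt0 : (0 < D)%N. Proof. exact: leq_trans D_ge4. Qed.

Let theta_sym i : (i <= D)%N -> theta (D - i) = - theta i.
Proof. exact: theta_opp. Qed.

Let theta0 : theta 0 = k. Proof. exact: theta_0. Qed.

Lemma theta_sqr_inj i j : (i <= D)%N -> (j <= D)%N ->
  (theta i ^+ 2 == theta j ^+ 2) = (i == j) || (i == D - j)%N.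
Proof.
move=> iD jD; apply/idP/idP => [|/orP[/eqP ->|/eqP ->] //].
  rewrite eqf_sqr => /orP[/eqP/(theta_inj theta_eig iD jD) ->|]; first by rewrite eqxx.
  rewrite -(theta_sym jD) => /eqP.
  by move/(theta_inj theta_eig iD (leq_subr _ _)) => ->; rewrite eqxx orbT.
by rewrite (theta_sym jD) sqrrN.
Qed.

Lemma theta_mono i j : (i <= j)%N -> (j <= D)%N -> theta j <= theta i.
Proof.
rewrite leq_eqVlt => /orP[/eqP ->//|ij jD]; exact/ltW/(theta_decr theta_eig).
Qed.

(** The sequence decreases from theta_i to theta_(D-i) = - theta_i, and j lies
    between i and D - i. *)
Lemma theta_sqr_le i j : (i <= j)%N -> (i + j <= D)%N -> theta j ^+ 2 <= theta i ^+ 2.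
Proof.
move=> ij ijD; have iD : (i <= D)%N by apply: leq_trans ijD; exact: leq_addr.
have jD : (j <= D)%N by apply: leq_trans ijD; exact: leq_addl.
have le1 := theta_mono ij jD.
have : theta (D - i) <= theta j by apply: theta_mono; rewrite ?leq_subr // leq_subRL.
rewrite theta_sym // => le2.
by rewrite -ler_sqrt ?sqr_ge0 // !sqrtr_sqr ler_normr ler_norml; lra.
Qed.

(** By the symmetry of the spectrum, theta_1 has the largest absolute value among
    the eigenvalues other than k and -k, and for odd D the eigenvalue theta_d
    has the smallest one. *)
Lemma theta_n_extremal :
  (forall j, (0 < j < D)%N -> theta j ^+ 2 <= theta n ^+ 2) \/
  (forall j, (0 < j < D)%N -> theta n ^+ 2 <= theta j ^+ 2).
Proof.
case: n_choice => [->|[oD ->]]; [left|right] => j /andP[j0 jD].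
  exact: theta_sqr_le.
have [jd|dj] := leqP j D./2; first by apply: theta_sqr_le => //; lia.
rewrite -[theta j ^+ 2]sqrrN -theta_sym; last exact: ltnW.
by apply: theta_sqr_le; lia.
Qed.

Definition quartic_poly (xi z : R) : R := (k ^+ 2 - z ^+ 2) * (xi - z ^+ 2).

Lemma quartic_poly_eq0 j : (j <= D)%N ->
  (quartic_poly (theta n ^+ 2) (theta j) == 0) =
    [|| j == 0, j == D, j == n | j == D - n]%N.
Proof.
move=> jD; have /andP[_ /ltnW nD] := n_bounds D_ge4 n_choice.
rewrite /quartic_poly -theta0 mulf_eq0 !subr_eq0 ![_ == theta j ^+ 2]eq_sym.
by rewrite !theta_sqr_inj // subn0 -orbA.
Qed.

Lemma quartic_poly_sign : exists s : R, s != 0 /\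
  forall j, (j <= D)%N -> 0 <= s * quartic_poly (theta n ^+ 2) (theta j).
Proof.
have k2 j : (j <= D)%N -> theta j ^+ 2 <= k ^+ 2.
  by move=> jD; rewrite -theta0 theta_sqr_le.
have [H|H] := theta_n_extremal; [exists 1|exists (-1)]; split=> [|j jD];
    rewrite ?oppr_eq0 ?oner_eq0 //.
all: have := quartic_poly_eq0 jD.
all: have [->|j0] := eqVneq j 0%N; first by rewrite /= => /eqP ->; rewrite mulr0.
all: have [->|jD'] := eqVneq j D; first by rewrite orbT /= => /eqP ->; rewrite mulr0.
all: move=> _; have {}H := H j; rewrite lt0n j0 ltn_neqAle jD' jD in H.
  by rewrite mul1r mulr_ge0 // subr_ge0 ?k2 ?H.
by rewrite mulN1r -mulrN opprB mulr_ge0 // subr_ge0 ?k2 ?H.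
Qed.

Lemma quartic_fun_mx (xi : R) : quartic e (real_complex R xi) =
  fun_mx A (fun z => ((valency e)%:R ^+ 2 - z * z) * (real_complex R xi - z * z)).
Proof.
have Ah : A \is hermsymmx by apply: adj_mx_herm.
have sq (c : C) : c%:M - A *m A = fun_mx A (fun z => c - z * z).
  rewrite fun_mxD fun_mx_cst //; congr (_ + _).
  rewrite (eq_fun_mx Ah (g := fun z => -1 * (z * z))) => [|z _]; last by rewrite mulN1r.
  by rewrite fun_mxZ fun_mxM fun_mx_id // scaleN1r.
by rewrite fun_mxM -!sq.
Qed.

Lemma quartic_polyC (xi z : R) :
  ((valency e)%:R ^+ 2 - real_complex R z * real_complex R z) *
    (real_complex R xi - real_complex R z * real_complex R z)
  = real_complex R (quartic_poly xi z).
Proof.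
by rewrite /quartic_poly -(rmorph_nat (real_complex R)) -!expr2 -!rmorphXn -!rmorphB -rmorphM.
Qed.

(** At xi = b_2 the quartic has trace 0. If b_2 were the extremal value theta_n^2, no
    two of its values at the eigenvalues would have opposite signs, so they would
    all be 0 and A would have at most four eigenvalues. *)
Lemma theta_n_neq_b2 : theta n ^+ 2 != b2.
Proof.
have Ah : A \is hermsymmx by apply: adj_mx_herm.
apply/eqP => nb2; have [s [s0 sge]] := quartic_poly_sign.
have tr0 : \tr (quartic e (real_complex R (theta n ^+ 2))) = 0.
  by rewrite mxtrace_quartic // nb2 rmorph_nat subrr mulr0 mul0r.
pose g z := ((valency e)%:R ^+ 2 - z * z) * (real_complex R (theta n ^+ 2) - z * z).
have evP r : exists2 j, (j <= D)%N & spectral_diag A 0 r = real_complex R (theta j).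
  exact/theta_eig.2/spectral_diag_eigenvalue.
have ge0 r : true -> 0 <= real_complex R s * g (spectral_diag A 0 r).
  have [j jD ->] := evP r.
  by rewrite /g quartic_polyC -rmorphM /= lecR sge.
have sum0 : \sum_r real_complex R s * g (spectral_diag A 0 r) = 0.
  by rewrite -mulr_sumr -mxtrace_fun_mx -quartic_fun_mx tr0 mulr0.
have [j jD] : exists2 j, (j <= D)%N & ~~ [|| j == 0, j == D, j == n | j == D - n]%N.
  (* These four indices do not exhaust 0, ..., D: theta_2 is left if n = 1, and
     theta_1 if n = d, as then D is odd and at least 5. *)
  case: n_choice => [->|[oD ->]]; [exists 2|exists 1%N]; move: D_ge4; lia.
rewrite -quartic_poly_eq0 // => /negP; apply.
have : eigenvalue A (real_complex R (theta j)) by apply/theta_eig.2; exists j.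
case/(eigenvalue_spectral_diag Ah) => r rj.
have := psumr_eq0P ge0 sum0 (i := r) isT; rewrite rj /g quartic_polyC -rmorphM /=.
by move/complexI/eqP; rewrite mulf_eq0 (negPf s0).
Qed.
End EigenvalueOrder.

(** * Vanishing idempotent components and a basis of the module *)

Theorem theorem13p1
  (R : realType) (X : finType) (e : rel X) (D : nat) (theta : nat -> R)
  (x : X) (n : nat) (W : {vspace 'cV[R[i]]_#|X|}) (v : 'cV[R[i]]_#|X|)
  (e_simple : simple_graph e) (e_connected : connected_graph e)
  (e_bipartite : bipartite e) (e_dreg : distance_regular e)
  (diamD : diameter e = D) (D_ge4 : (4 <= D)%N) (k_ge3 : (3 <= valency e)%N)
  (theta_eig : ordered_eigenvalues e D theta)
  (n_choice : n = 1%N \/ (odd D /\ n = D./2))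
  (W_irr : irreducible_Tmodule e x W) (W_thin : thin e x W)
  (W_endpoint : has_endpoint e x W 2)
  (W_local : has_local_eigenvalue e x W
     (real_complex R
        (- 1 - ((b_num e 2)%:R * (b_num e 3)%:R)
               / (theta n ^+ 2 - (b_num e 2)%:R))))
  (v_in : v \in mximg (dual_idem R e x 2) W) (v_neq0 : v != 0) :
  [/\ forall w, w \in W <-> exists2 B, bose_mesner e B & w = B *m v,
      basis_of W [seq prim_idem e theta i *m v
                 | i <- iota 1 D.-1 & (i != n) && (i != (D - n)%N)]
    & [/\ prim_idem e theta 0 *m v = 0,
          prim_idem e theta n *m v = 0,
          prim_idem e theta (D - n) *m v = 0
        & prim_idem e theta D *m v = 0]].
Proof.
have [e_sym e_irr] := e_simple; subst D.
have X_gt0 : (0 < #|X|)%N by apply/card_gt0P; exists x.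
have D_gt0 : (0 < diameter e)%N by exact: leq_trans D_ge4.
have Ah : adj_mx R e \is hermsymmx by exact: adj_mx_herm.
have [W_T _ _] := W_irr.
have vW : v \in W.
  by have [w wW ->] := mximgP v_in; apply: dual_idem_Tmodule => //; exact: leq_trans D_ge4.
have /andP[n_gt0 n_lt] := n_bounds D_ge4 n_choice.
pose A := adj_mx R e; pose th i := real_complex R (theta i).
pose E i := fun_mx A (eigen_ind (th i)).
have primE i : prim_idem e theta i = E i by rewrite /prim_idem eigproj_fun_mx.
have th_inj i j : (i <= diameter e)%N -> (j <= diameter e)%N -> th i = th j -> i = j.
  by move=> iD jD /complexI; apply: (theta_inj theta_eig).
have E_bm i : bose_mesner e (E i).
  apply: (eigen_ind_gen_subalg Ah (s := [seq th j | j <- iota 0 (diameter e).+1])).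
  move=> z /theta_eig.2[j jD ->]; apply/mapP; exists j => //.
  by rewrite mem_iota add0n ltnS.
(* The squared norm of E_j v is a nonzero multiple of the value of the quartic at
   theta_j, whose roots among the eigenvalues are known. *)
have E_eq0 j : (j <= diameter e)%N ->
    (E j *m v == 0) = [|| j == 0, j == diameter e, j == n | j == diameter e - n]%N.
  move=> jD.
  rewrite -(quartic_poly_eq0 e_sym e_irr e_connected e_dreg e_bipartite
              D_ge4 X_gt0 theta_eig n_choice jD).
  set xi := theta n ^+ 2 in W_local *.
  have xi_b2 : xi - (b_num e 2)%:R != 0.
    by rewrite subr_eq0; apply: theta_n_neq_b2.
  set eta := real_complex R _ in W_local.
  have eta_def : eta * (real_complex R xi - (b_num e 2)%:R) =
      (b_num e 2)%:R - real_complex R xi - (b_num e 2)%:R * (b_num e 3)%:R.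
    rewrite -!(rmorph_nat (real_complex R)) -!rmorphM -!rmorphB -rmorphM /=.
    by congr (real_complex R _); rewrite mulrBl divfK //; ring.
  have := moments_quartic e_sym e_irr e_connected e_dreg e_bipartite X_gt0 D_ge4 eta_def
    (moment2 W_local v_in)
    (moment4 e_sym e_irr e_connected e_bipartite e_dreg D_ge4 X_gt0
       W_T W_endpoint W_local v_in)
    (moment0 e_sym e_connected e_bipartite v_in) (E_bm j).
  rewrite quartic_fun_mx // (mul_eigen_ind Ah) quartic_polyC mxtraceZ.
  have v2 : qform v 1%:M != 0.
    by rewrite qform_idem ?mul1mx // trmx1 map_mx1.
  have trE : \tr (E j) != 0.
    by rewrite gt_eqF // mxtrace_eigen_ind_gt0 //; apply/theta_eig.2; exists j.
  have q0 : ((valency e)%:R * (b_num e 1)%:R * (real_complex R xi - (b_num e 2)%:R)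
      * #|X|%:R : R[i]) != 0.
    rewrite -(rmorph_nat (real_complex R) (b_num e 2)) -rmorphB !mulf_neq0 //.
    - by rewrite pnatr_eq0 -lt0n; apply: leq_trans k_ge3.
    - by rewrite pnatr_eq0 -lt0n; apply: b_gt0 => //; exact: leq_trans D_ge4.
    - by rewrite fmorph_eq0.
    - by rewrite pnatr_eq0 -lt0n.
  rewrite -(qform_idem _ (eigen_ind_adjoint _ _)) ?eigen_ind_idem //.
  move=> Fq; apply/idP/idP => [/eqP F0|/eqP qj0].
    move/eqP: Fq; rewrite F0 mul0r eq_sym mulf_eq0 (negPf v2) /=.
    by rewrite mulf_eq0 (negPf trE) orbF fmorph_eq0.
  by move/eqP: Fq; rewrite qj0 rmorph0 mul0r mulr0 mulf_eq0 (negPf q0) orbF.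
pose s := [seq i <- iota 1 (diameter e).-1 | (i != n) && (i != (diameter e - n)%N)].
have sP i : (i \in s) = (i <= diameter e)%N && (E i *m v != 0).
  rewrite mem_filter mem_iota add1n prednK //.
  have [iD|iD] := leqP i (diameter e); last first.
    by rewrite [(i < diameter e)%N]ltnNge (ltnW iD) !andbF.
  by rewrite E_eq0 // !negb_or lt0n ltn_neqAle iD andbT -!andbA; do !bool_congr.
pose U := <<[seq E i *m v | i <- s]>>%VS.
have vU : v \in U.
  have -> : v = \sum_(i < (diameter e).+1) E i *m v.
    rewrite -mulmx_suml (sum_eigen_ind Ah) ?mul1mx // => [i j|z /theta_eig.2[j jD ->]].
      by move/th_inj => ij; apply: ord_inj; apply: ij; rewrite -ltnS.
    by exists (inord j); rewrite /th inordK.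
  apply: memv_suml => i _; have [->|Ei] := eqVneq (E i *m v) 0; first exact: mem0v.
  by apply/memv_span/map_f; rewrite sP Ei -ltnS ltn_ord.
have WU : (W <= U)%VS.
  apply: (thin_irreducible_generated e_sym e_connected W_irr W_thin W_endpoint _ v_in) => //.
    exact: leq_trans D_ge4.
  by move=> u; apply: span_eigen_ind_stable.
have UW : (U <= W)%VS.
  by apply/span_subvP => u /mapP[i _ ->]; apply: (bose_mesner_Tmodule W_T).
split.
- move=> w; split=> [/(subvP WU)|[B BM ->]]; last exact: (bose_mesner_Tmodule W_T).
  by apply: span_eigen_ind_gen_subalg => i _; apply: E_bm.
- rewrite (eq_map (g := fun i => E i *m v)) => [|i]; last by rewrite primE.
  apply/andP; split; first by rewrite eqEsubv UW.
  apply: free_eigen_ind => //; first by rewrite filter_uniq ?iota_uniq.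
    by move=> i j; rewrite !sP => /andP[iD _] /andP[jD _]; apply: th_inj.
  by move=> i; rewrite sP => /andP[].
- rewrite !primE; split; apply/eqP; rewrite E_eq0 ?eqxx ?orbT //; try exact: ltnW.
  exact: leq_subr.
Qed.
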